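(* Let $X$ be a (zero-dimensional) first-countable space. If $X^\omega$ is ultraparacompact and non-Lindelöf, then $X^\omega$ is h-homogeneous.
   Context: All spaces are assumed to be Tychonoff. Powers carry the product topology. A subset of a space is clopen if it is closed and open. A space is zero-dimensional if it has a base consisting of clopen sets. A space is ultraparacompact if every open cover of it has a refinement (again a cover) consisting of pairwise disjoint clopen sets; every ultraparacompact space is zero-dimensional. A space is h-homogeneous if all of its non-empty clopen subsets (with the subspace topology) are homeomorphic to each other. *)

(* Defs.v *)
From mathcomp Require Import all_boot all_classical all_reals.
From mathcomp Require Import topology normedtype.

Set Implicit Arguments.
Unset Strict Implicit.
Unset Printing Implicit Defensive.

Local Open Scope classical_set_scope.

Definition tychonoff_space (T : topologicalType) : Prop :=
  hausdorff_space T /\ completely_regular_space T.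

(* A local base at x may be any countable family of (not necessarily open)
   neighbourhoods of x. *)
Definition first_countable (T : topologicalType) : Prop :=
  forall x : T, exists2 B : set (set T), countable B & nbhs x = filter_from B id.

(* This is not the library's [zero_dimensional], which only asks that distinct
   points be separated by a clopen set. *)
Definition has_clopen_base (T : topologicalType) : Prop :=
  exists2 B : set (set T), B `<=` clopen & basis B.

Definition open_cover (T : topologicalType) (U : set (set T)) : Prop :=
  U `<=` open /\ cover U id = [set: T].

Definition lindelof (T : topologicalType) : Prop :=
  forall U : set (set T), open_cover U ->
    exists V : set (set T), [/\ V `<=` U, countable V & cover V id = [set: T]].

Definition refines (T : Type) (V U : set (set T)) : Prop :=
  forall A, V A -> exists2 B, U B & A `<=` B.

(* [trivIset V id]: two members of V that meet are equal. *)
Definition ultraparacompact (T : topologicalType) : Prop :=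
  forall U : set (set T), open_cover U ->
    exists V : set (set T),
      [/\ refines V U, cover V id = [set: T], V `<=` clopen & trivIset V id].

Definition homeomorphic (S T : topologicalType) : Prop :=
  exists (f : S -> T) (g : T -> S),
    [/\ continuous f, continuous g, cancel f g & cancel g f].

(* [set_type A] is the subtype of the elements of A, with the subspace
   topology; unlike [subspace A], it has no points outside A. *)
Definition h_homogeneous (T : topologicalType) : Prop :=
  forall A B : set T, clopen A -> clopen B -> A !=set0 -> B !=set0 ->
    homeomorphic (set_type A) (set_type B).

(* Main.v *)
Require Import Defs.
From HB Require Import structures.
From Stdlib Require Cantor.
From mathcomp Require Import all_boot finmap all_classical all_reals.
From mathcomp Require Import topology normedtype.

(** Ultraparacompactness and the failure of compactness give a continuous
    surjection [kappa : X -> nat].  It is enough to show that every non-empty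
    clopen box of [X^omega] is homeomorphic to one fixed space, [(X * nat)^omega].
    Indeed [X^omega] is then homeomorphic to each of the disjoint clopen boxes
    [kappa (z 0) = k], hence absorbs any clopen set [E] by a Hilbert hotel
    argument; since a non-empty clopen set [C] contains a box [R], which is a copy
    of [X^omega], [C] is homeomorphic to [X^omega] too.

    To remove a clopen factor [W] from [W * (X * nat)^omega], fix a decreasing
    clopen base [u] at some point [q] of [W = u 0] and insert the letter [w : W]
    into the sequence at position [n] when [w] lies in [u n] but not in [u n.+1],
    and nowhere when [w = q].  The marks in [nat] leave room to recognize the
    inserted letter.  In [X^omega] no marks are given, but a coordinate [b]
    provides the mark [kappa b]; once the mark is known, [b] itself is a letter of
    the clopen set [kappa @^-1` [set kappa b]], which is removed in the same way,
    inside a sequence of its own. *)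

Set Implicit Arguments.
Unset Strict Implicit.
Unset Printing Implicit Defensive.

Local Open Scope classical_set_scope.

(** * Continuity at a point and in powers *)

Lemma clopenP (S : topologicalType) (A : set S) (x : S) :
  clopen A -> \forall y \near x, (y \in A) = (x \in A).
Proof.
move=> [oA cA]; case: (boolP (x \in A)) => xA.
  have: nbhs x A by apply: open_nbhs_nbhs; split => //; rewrite inE in xA.
  by apply: filterS => y Ay; apply/mem_set.
have: nbhs x (~` A).
  apply: open_nbhs_nbhs; split; first exact: closed_openC.
  by move/negP: xA; rewrite inE.
by apply: filterS => y nAy; apply/negP; rewrite inE.
Qed.

Lemma continuous_at_if (S Y : topologicalType) (b : S -> bool) (f g : S -> Y)
    (x : S) :
  (\forall y \near x, b y = b x) ->
  {for x, continuous f} -> {for x, continuous g} ->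
  {for x, continuous (fun y => if b y then f y else g y)}.
Proof.
move=> bx fx gx U /= Ux; rewrite /= in fx gx Ux *.
case: (boolP (b x)) Ux bx => [bxT /fx Ux bx|/negbTE bxF /gx Ux bx].
  by apply: filterS2 bx Ux => y /= ->.
by apply: filterS2 bx Ux => y /= ->.
Qed.

(** Lets locally constant data, such as a key or the first hit, be frozen before continuity is
    checked. *)
Lemma near_continuous_at (S Y : topologicalType) (f g : S -> Y) (x : S) :
  (\forall y \near x, f y = g y) ->
  {for x, continuous g} -> {for x, continuous f}.
Proof.
move=> fg gx U Ux; have fgx : f x = g x by exact: nbhs_singleton fg.
by move: Ux; rewrite fgx => /gx; apply: filterS2 fg => y /= ->.
Qed.

Lemma ptws_continuous_at (S Y : topologicalType) (f : S -> {ptws nat -> Y})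
    (x : S) :
  (forall n, {for x, continuous (fun y => f y n)}) -> {for x, continuous f}.
Proof.
move=> fx; apply/cvg_sup => n U [?/= [[W oW <-]] /= Wx /filterS]; apply.
by apply: fx; exact: open_nbhs_nbhs.
Qed.

Lemma ptws_proj_continuous (Y : topologicalType) (n : nat) :
  continuous (fun z : {ptws nat -> Y} => z n).
Proof. exact: (@proj_continuous nat (fun=> Y) n). Qed.

Lemma near_nat (S : topologicalType) (f : S -> nat) (x : S) :
  {for x, continuous f} -> \forall y \near x, f y = f x.
Proof. by move=> fx; exact: (fx [set f x] (discrete_set1 _)). Qed.

Lemma near_continuous_at_nat (S : topologicalType) (f : S -> nat) (x : S) :
  (\forall y \near x, f y = f x) -> {for x, continuous f}.
Proof. by move=> fx; apply: (near_continuous_at fx); exact: cvg_cst. Qed.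

Lemma continuous_at_pair (S Y Y' : topologicalType) (f : S -> Y) (g : S -> Y')
    (x : S) :
  {for x, continuous f} -> {for x, continuous g} ->
  {for x, continuous (fun y => (f y, g y))}.
Proof. by move=> fx gx; exact: cvg_pair. Qed.

(** * Inserting a letter into a sequence of marked letters *)

(** Inclusions need not be strict: if [q] is isolated, the annuli are eventually empty. *)
Definition clopen_base (X : topologicalType) (u : nat -> set X) (q : X) :=
  [/\ forall n, clopen (u n), forall n, u n.+1 `<=` u n, forall n, u n q &
      forall U, nbhs q U -> exists n, u n `<=` U].

Section Insertion.
Context {X : topologicalType}.
Variables (u : nat -> set X).
Implicit Types (w : X) (s t : nat -> X * nat) (n : nat).

Definition annulus n := u n `\` u n.+1.

Definition mark n (y : X * nat) := (y.1, y.2 + (y.1 \in annulus n)).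

Definition unmark n (y : X * nat) := (y.1, y.2 - (y.1 \in annulus n)).

(* A letter of [annulus n] with mark 0 can only come from [w], because [mark]
   raises the marks of all other letters of [annulus n] standing before [w]. *)
Definition insert w t n : X * nat :=
  if w \in u n.+1 then mark n (t n)
  else if w \in u n then (w, 0)
  else t n.-1.

Definition hit s n := ((s n).1 \in annulus n) && ((s n).2 == 0).

(** A hit at or before [n] means that the inserted letter has been passed, so letters stand one
    place too far; before it, only marks have to be lowered. *)
Definition delete s n : X * nat :=
  if has (hit s) (iota 0 n.+1) then s n.+1 else unmark n (s n).

(** Letters after the inserted one may produce further hits, so the first hit counts. A sequence
    without hits carries the letter [q]. *)
Definition inserted q s : X :=
  if pselect (exists n, hit s n) is left h then (s (ex_minn h)).1 else q.

Lemma markK n : cancel (mark n) (unmark n).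
Proof. by case=> x k; rewrite /mark /unmark /= addnK. Qed.

Lemma hasP_iota (a : pred nat) n :
  reflect (exists2 m, m < n & a m) (has a (iota 0 n)).
Proof.
apply: (iffP hasP) => -[m mn am]; exists m => //; move: mn; rewrite mem_iota //.
Qed.

Variable q : X.
Hypotheses (uq : clopen_base u q) (hX : hausdorff_space X).

Lemma clopen_base_le m n : m <= n -> u n `<=` u m.
Proof.
case: uq => _ udec _ _; elim: n => [|n IH]; first by rewrite leqn0 => /eqP ->.
rewrite leq_eqVlt => /orP[/eqP -> //|]; rewrite ltnS => /IH.
by apply: subset_trans; exact: udec.
Qed.

Lemma clopen_annulus n : clopen (annulus n).
Proof.
case: uq => uc _ _ _; case: (uc n) => on cn; case: (uc n.+1) => oS cS.
by split; rewrite /annulus setDE;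
  [apply: openI => //; exact: closed_openC | apply: closedI => //; exact: open_closedC].
Qed.

Lemma bigcap_clopen_base x : (forall n, u n x) -> x = q.
Proof.
case: uq => uc _ _ ub ux; apply: hX => A B Ax /ub [n nB].
by exists x; split; [exact: nbhs_singleton | apply: nB].
Qed.

(** A point of [u 0] in no annulus passes from each [u n] to [u n.+1], and only [q] lies in all of
    them. *)
Lemma annulusP w : u 0 w -> (exists n, annulus n w) \/ w = q.
Proof.
move=> w0; case: (pselect (exists n, annulus n w)) => [|nw]; first by left.
right; apply: bigcap_clopen_base; elim=> // n IH.
by apply: contrapT => nwS; apply: nw; exists n.
Qed.

Lemma insert_lt w t n : u n.+1 w -> insert w t n = mark n (t n).
Proof. by move=> wn; rewrite /insert mem_set. Qed.

Lemma insert_eq w t n : annulus n w -> insert w t n = (w, 0).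
Proof. by move=> [wn nw]; rewrite /insert memNset// mem_set. Qed.

Lemma insert_gt w t n : ~ u n w -> insert w t n = t n.-1.
Proof.
move=> nw; rewrite /insert !memNset // => wn.
by apply: nw; apply: (@clopen_base_le n n.+1).
Qed.

(** The raised marks exclude false hits before the inserted letter. *)
Lemma hit_mark w t n : u n.+1 w -> hit (insert w t) n = false.
Proof.
move=> wn; rewrite /hit insert_lt //= addn_eq0.
by case: (_ \in _); rewrite /= ?andbF.
Qed.

Lemma hit_insert w t n : annulus n w -> hit (insert w t) n.
Proof. by move=> wn; rewrite /hit insert_eq //= mem_set. Qed.

(** By [hit_mark] the first hit is not before the position of [w], and by minimality not after it.
    For [w = q] there is no hit, and the default is right. *)
Lemma insertedK w t : u 0 w -> inserted q (insert w t) = w.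
Proof.
move=> w0; rewrite /inserted; case: pselect => [h|nh].
  case: ex_minnP => m hm mmin.
  have nwm : ~ u m.+1 w by move=> wm; rewrite hit_mark in hm.
  suff wm : u m w by rewrite insert_eq.
  have [[n wn]|wq] := annulusP w0; last first.
    by rewrite wq; case: uq.
  have := mmin n (hit_insert t wn); move/clopen_base_le; apply.
  by case: wn.
have [[n wn]|//] := annulusP w0.
by case: nh; exists n; exact: hit_insert.
Qed.

(** A hit at or before [n] exists exactly when [w] lies outside [u n.+1], so [delete] takes the
    branch that undoes [insert]. *)
Lemma insertK w t n : u 0 w -> delete (insert w t) n = t n.
Proof.
move=> w0; rewrite /delete; case: hasP_iota => [[m mn hm]|nh].
  have nwm : ~ u m.+1 w by move=> wm; rewrite hit_mark in hm.
  by rewrite insert_gt // => /(clopen_base_le mn).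
suff wn : u n.+1 w by rewrite insert_lt// markK.
have [[m wm]|->] := annulusP w0; last by case: uq.
case: (ltnP m n.+1) => [mn|nm].
  by case: nh; exists m => //; exact: hit_insert.
by apply: clopen_base_le nm _ _; case: wm.
Qed.

Lemma inserted_base s : u 0 (inserted q s).
Proof.
rewrite /inserted; case: pselect => [h|_]; last by case: uq.
case: ex_minnP => m /andP[+ _] _; rewrite inE => -[+ _].
exact: clopen_base_le.
Qed.

(** The letter at the first hit [m] lies in [annulus m], so [insert] returns it to position [m]. *)
Lemma deleteK s n : insert (inserted q s) (delete s) n = s n.
Proof.
(* Truncated subtraction loses information only at mark 0 inside the annulus, which is a hit. *)
have unmarkK m : ~~ hit s m -> mark m (unmark m (s m)) = s m.
  rewrite /hit /mark /unmark; case: (s m) => x k /=.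
  by case: (_ \in _) => /=; rewrite ?subn0 ?addn0// => k0; rewrite subnK// lt0n.
rewrite /inserted; case: pselect => [h|nh]; last first.
  have nhit m : ~~ hit s m by apply/negP => hm; apply: nh; exists m.
  rewrite insert_lt; last by case: uq.
  rewrite /delete; case: hasP_iota => [[m _]|_]; last exact: unmarkK.
  by rewrite (negbTE (nhit m)).
case: ex_minnP => m hm mmin.
have /andP[/set_mem [am nm] /eqP sm0] := hm.
case: (ltngtP n m) => [nm'|mn|->].
- rewrite insert_lt; last exact: clopen_base_le nm' _ am.
  rewrite /delete; case: hasP_iota => [[k kn hk]|nk].
    by have := mmin k hk; rewrite leqNgt (leq_trans kn).
  by rewrite unmarkK //; apply/negP => hn; apply: nk; exists n.
- rewrite insert_gt; last by move=> /(clopen_base_le mn).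
  rewrite /delete prednK ?(leq_ltn_trans _ mn) //.
  by case: hasP_iota => // -[]; exists m.
- by rewrite insert_eq // -sm0 -surjective_pairing.
Qed.

(** * Continuity of insertion and deletion *)

Section Continuity.
Context {S : topologicalType}.
Variable x : S.

Lemma near_mem_comp (f : S -> X) (A : set X) : clopen A ->
  {for x, continuous f} -> \forall y \near x, (f y \in A) = (f x \in A).
Proof. by move=> cA fx; exact: (fx _ (clopenP (f x) cA)). Qed.

Lemma continuous_at_fst (Y Y' : topologicalType) (f : S -> Y * Y') :
  {for x, continuous f} -> {for x, continuous (fun y => (f y).1)}.
Proof. by move=> fx; apply: continuous_comp fx _; exact: cvg_fst. Qed.

Lemma continuous_at_snd (Y Y' : topologicalType) (f : S -> Y * Y') :
  {for x, continuous f} -> {for x, continuous (fun y => (f y).2)}.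
Proof. by move=> fx; apply: continuous_comp fx _; exact: cvg_snd. Qed.

(** The parameter [op] covers both [mark] and [unmark]. *)
Lemma continuous_at_remark (op : nat -> bool -> nat) n (f : S -> X * nat) :
  {for x, continuous f} ->
  {for x, continuous (fun y => ((f y).1, op (f y).2 ((f y).1 \in annulus n)))}.
Proof.
move=> fx; apply: continuous_at_pair; first exact: continuous_at_fst.
apply: near_continuous_at_nat.
have := near_nat (continuous_at_snd fx).
apply: filterS2 (near_mem_comp (clopen_annulus n) (continuous_at_fst fx)).
by move=> y -> ->.
Qed.

Lemma continuous_at_insert (w : S -> X) (t : S -> nat -> X * nat) n :
  {for x, continuous w} ->
  (forall m, {for x, continuous (fun y => t y m)}) ->
  {for x, continuous (fun y => insert (w y) (t y) n)}.
Proof.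
case: uq => uc _ _ _ wx tx.
apply: continuous_at_if; first exact: near_mem_comp.
  exact: (@continuous_at_remark (fun k (b : bool) => k + b) n _ (tx n)).
apply: continuous_at_if => //; first exact: near_mem_comp.
by apply: continuous_at_pair => //; exact: cvg_cst.
Qed.

Variable s : S -> nat -> X * nat.
Hypothesis sx : forall m, {for x, continuous (fun y => s y m)}.

Lemma near_hit n : \forall y \near x, hit (s y) n = hit (s x) n.
Proof.
have := near_nat (continuous_at_snd (@sx n)).
apply: filterS2 (near_mem_comp (clopen_annulus n) (continuous_at_fst (@sx n))).
by rewrite /hit => y -> ->.
Qed.

Lemma near_hit_le n :
  \forall y \near x, forall m, m <= n -> hit (s y) m = hit (s x) m.
Proof.
elim: n => [|n].
  by apply: filterS (near_hit 0) => y ? m; rewrite leqn0 => /eqP ->.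
apply: filterS2 (near_hit n.+1) => y hn IH m.
by rewrite leq_eqVlt => /orP[/eqP -> //|]; exact: IH.
Qed.

Lemma continuous_at_delete n : {for x, continuous (fun y => delete (s y) n)}.
Proof.
apply: continuous_at_if => //.
  apply: filterS (near_hit_le n) => y yx; apply/eq_in_has => m.
  by rewrite mem_iota add0n => /yx.
exact: (@continuous_at_remark (fun k (b : bool) => k - b) n _ (@sx n)).
Qed.

Lemma continuous_at_inserted : {for x, continuous (fun y => inserted q (s y))}.
Proof.
rewrite /=; case: (pselect (exists n, hit (s x) n)) => [h|nh].
  case: (ex_minnP h) => m hm mmin.
  apply: (@near_continuous_at _ _ _ (fun y => (s y m).1)); last first.
    exact: continuous_at_fst.
  apply: filterS (near_hit_le m) => y yx; rewrite /inserted.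
  case: pselect => [h'|[]]; last by exists m; rewrite yx.
  case: ex_minnP => k hk kmin; suff -> : k = m by [].
  have km : k <= m by apply: kmin; rewrite yx.
  by apply/eqP; rewrite eqn_leq km mmin // -yx.
(* Without a hit at [x], nearby sequences have no hit up to [n]; their letter is [q] or lies in a
   later annulus, hence in [u n]. *)
have sq : inserted q (s x) = q by rewrite /inserted; case: pselect.
case: uq => _ _ un ub U /=; rewrite sq => /ub [n nU].
apply: filterS (near_hit_le n) => y yx; apply: nU.
rewrite /inserted; case: pselect => // h.
case: ex_minnP => k hk _; case: (leqP k n) => [kn|/ltnW nk].
  by case: nh; exists k; rewrite -yx.
by apply: (clopen_base_le nk); case/andP: hk => /set_mem[].
Qed.

End Continuity.
End Insertion.

(** * Coding a box *)

(** The maps are total, with continuity taken in the ambient spaces; at points of open sets this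
    agrees with continuity on the subspace. *)
Definition homeomorphic_on (S T : topologicalType) (A : set S) (B : set T) :=
  exists (f : S -> T) (g : T -> S),
    (forall x, A x -> [/\ B (f x), g (f x) = x & {for x, continuous f}]) /\
    (forall y, B y -> [/\ A (g y), f (g y) = y & {for y, continuous g}]).

Section Coding.
Context {X : topologicalType}.
Variables (kappa : X -> nat) (r : nat).
Variables (e : nat -> nat -> nat -> set X) (q : nat -> nat -> X).
Hypotheses (hX : hausdorff_space X) (kappac : continuous kappa).
Hypothesis e_base : forall i k, clopen_base (e i k) (q i k).
Hypothesis e0_kappa : forall i k, r < i -> e i k 0 = kappa @^-1` [set k].
Local Notation Z := {ptws nat -> X}.
Local Notation T := {ptws nat -> (X * nat)%type}.
Implicit Types (z : Z) (s : T) (i j m n : nat).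

(* A sequence is read as [z_0, ..., z_r, a_0, b_0, a_1, b_1, ...]; the pending
   letters are [z_0, ..., z_r, b_0, b_1, ...] and the plain ones [a_0, a_1, ...].
   The [i]-th pending letter is inserted into the [i]-th row, which consists of
   the letters [a_n] marked with [kappa b_n], for [n] coding a pair [(i, m)]. *)
Definition pending z i : X := if i <= r then z i else z (r.+2 + (i - r.+1).*2).

Definition plain z n : X := z (r.+1 + n.*2).

(** The [i]-th pending letter belongs to [e i (key z i) 0]: for [i <= r] a fixed factor of the box,
    under a dummy key 0, and otherwise the fibre of [kappa] containing the letter. *)
Definition key z i : nat := if i <= r then 0 else kappa (pending z i).

Definition row_in z i m : X * nat :=
  let n := Cantor.to_nat (i, m) in (plain z n, kappa (pending z (r.+1 + n))).

Definition encode z : T := fun n =>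
  let: (i, m) := Cantor.of_nat n in
  insert (e i (key z i)) (pending z i) (row_in z i) m.

Definition row s i m : X * nat := s (Cantor.to_nat (i, m)).

(* The clopen set containing the [i]-th pending letter, needed to decode row [i],
   is read off an earlier row [j < i] (see [row_of_lt]); hence [i.+1] steps of
   fuel suffice. *)
Fixpoint key_fuel (f : nat) s i : nat :=
  if f is f'.+1 then
    if i <= r then 0 else
      let: (j, m) := Cantor.of_nat (i - r.+1) in
      (delete (e j (key_fuel f' s j)) (row s j) m).2
  else 0.

Definition out_key s i : nat := key_fuel i.+1 s i.

Definition out_pending s i : X :=
  inserted (e i (out_key s i)) (q i (out_key s i)) (row s i).

Definition out_row s i m : X * nat := delete (e i (out_key s i)) (row s i) m.

(** Offsets from [r.+1] alternate between plain letters (even) and pending ones (odd). The marks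
    need no coordinates, being the values of [kappa] at pending letters. *)
Definition decode s : Z := fun k =>
  if k <= r then out_pending s k else
    let n := (k - r.+1)./2 in
    if odd (k - r.+1) then out_pending s (r.+1 + n)
    else let: (i, m) := Cantor.of_nat n in (out_row s i m).1.

Lemma row_index_le j m : j <= Cantor.to_nat (j, m).
Proof.
by apply/leP; apply: PeanoNat.Nat.le_trans (Cantor.to_nat_non_decreasing j m);
  rewrite PeanoNat.Nat.add_comm; exact: PeanoNat.Nat.le_add_r.
Qed.

(** A Cantor code is at least its first component; this makes the recursion on rows well founded. *)
Lemma row_of_lt i j m : r < i -> Cantor.of_nat (i - r.+1) = (j, m) -> j < i.
Proof.
move=> ri ejm; have := row_index_le j m.
rewrite -ejm Cantor.cancel_to_of => /leq_ltn_trans -> //.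
by rewrite ltn_subrL /= (leq_ltn_trans _ ri).
Qed.

Lemma key_fuelE f s i : i < f -> key_fuel f s i = out_key s i.
Proof.
have [n] := ubnP i; elim: n f i => // n IH [//|f] i /ltnSE ni /ltnSE fi.
rewrite /out_key /=; case: leqP => // ri.
case ejm: Cantor.of_nat => [j m]; have ji := row_of_lt ri ejm.
by rewrite (IH f) ?(leq_trans ji) // (IH i) // (leq_trans ji).
Qed.

(** The recursion for [out_key], freed from fuel. *)
Lemma out_keyE s j m :
  out_key s (r.+1 + Cantor.to_nat (j, m)) = (out_row s j m).2.
Proof.
have ri : r < r.+1 + Cantor.to_nat (j, m) by exact: leq_addr.
have ejm : Cantor.of_nat (r.+1 + Cantor.to_nat (j, m) - r.+1) = (j, m).
  by rewrite addKn Cantor.cancel_of_to.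
move: (r.+1 + _) ri ejm => i ri ejm.
by rewrite {1}/out_key /= leqNgt ri /= ejm key_fuelE // (row_of_lt ri ejm).
Qed.

Lemma out_key_le s i : i <= r -> out_key s i = 0.
Proof. by rewrite /out_key /= => ->. Qed.

Lemma pending_base z i : (forall i, i <= r -> e i 0 0 (z i)) ->
  e i (key z i) 0 (pending z i).
Proof.
move=> ez; rewrite /key; case: leqP => ir; last by rewrite e0_kappa.
by rewrite /pending ir; exact: ez.
Qed.

Lemma row_encode z i :
  row (encode z) i = insert (e i (key z i)) (pending z i) (row_in z i).
Proof. by apply/funext => m; rewrite /row /encode Cantor.cancel_of_to. Qed.

(** Strong induction: beyond [r], the key is a mark in an earlier row, which is deleted correctly
    because its own key is already known. *)
Lemma key_encode z i : (forall i, i <= r -> e i 0 0 (z i)) ->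
  out_key (encode z) i = key z i.
Proof.
move=> ez; have [n] := ubnP i; elim: n i => // n IH i /ltnSE ni.
case: (leqP i r) => ri; first by rewrite out_key_le // /key ri.
case ejm: (Cantor.of_nat (i - r.+1)) => [j m]; have ji := row_of_lt ri ejm.
have -> : i = r.+1 + Cantor.to_nat (j, m).
  by rewrite -ejm Cantor.cancel_to_of subnKC.
rewrite out_keyE /out_row IH ?(leq_trans ji) //.
rewrite row_encode (insertK (e_base _ _) hX) //; last exact: pending_base.
by rewrite /row_in /key leqNgt leq_addr.
Qed.

Lemma encodeK z : (forall i, i <= r -> e i 0 0 (z i)) -> decode (encode z) = z.
Proof.
move=> ez.
have pE i : out_pending (encode z) i = pending z i.
  rewrite /out_pending key_encode // row_encode (insertedK (e_base _ _) hX) //.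
  exact: pending_base.
apply/funext => k; rewrite /decode; case: leqP => kr.
  by rewrite pE /pending kr.
have kE := odd_double_half (k - r.+1).
case: ifP => ok; rewrite ok ?add1n ?add0n in kE.
  by rewrite pE /pending leqNgt leq_addr /= addKn addSnnS kE subnKC.
case ejm: Cantor.of_nat => [j m].
rewrite /out_row key_encode // row_encode (insertK (e_base _ _) hX) //.
  by rewrite /row_in -ejm Cantor.cancel_to_of /plain /= kE subnKC.
exact: pending_base.
Qed.

Lemma pending_decode s i : pending (decode s) i = out_pending s i.
Proof.
rewrite /pending; case: leqP => ir; rewrite /decode ?ir //.
rewrite leqNgt ltn_addr // addSnnS addKn /= odd_double /= uphalf_double.
by rewrite subnKC.
Qed.

Lemma plain_decode s j m :
  plain (decode s) (Cantor.to_nat (j, m)) = (out_row s j m).1.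
Proof.
rewrite /plain /decode leqNgt ltn_addr // addKn odd_double doubleK.
by rewrite Cantor.cancel_of_to.
Qed.

Lemma out_pending_base s i : e i (out_key s i) 0 (out_pending s i).
Proof. exact: inserted_base. Qed.

(** The decoded letter lies in the fibre of [kappa] that its key names. *)
Lemma key_decode s i : key (decode s) i = out_key s i.
Proof.
rewrite /key; case: leqP => ir; first by rewrite out_key_le.
by rewrite pending_decode; have := out_pending_base s i; rewrite e0_kappa.
Qed.

Lemma decodeK s : encode (decode s) = s.
Proof.
apply/funext => n; rewrite /encode.
case ejm: (Cantor.of_nat n) => [j m]; rewrite key_decode pending_decode.
have -> : row_in (decode s) j = out_row s j.
  apply/funext => m'; rewrite /row_in plain_decode [RHS]surjective_pairing.
  congr (_, _); rewrite -out_keyE -key_decode /key leqNgt leq_addr //.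
rewrite /out_row /out_pending (deleteK (e_base _ _)) //.
by rewrite /row -ejm Cantor.cancel_to_of.
Qed.

Lemma decode_box s i : i <= r -> e i 0 0 (decode s i).
Proof.
move=> ir; have := out_pending_base s i; rewrite out_key_le //.
by rewrite /decode ir.
Qed.

Lemma pending_continuous i : continuous (pending^~ i).
Proof. by rewrite /pending; case: (i <= r); exact: ptws_proj_continuous. Qed.

Lemma near_key z i : \forall y \near z, key y i = key z i.
Proof.
rewrite /key; case: (i <= r); first by apply: filterE.
by apply: near_nat; apply: continuous_comp; [exact: pending_continuous|exact: kappac].
Qed.

Lemma encode_continuous : continuous encode.
Proof.
move=> z; apply: ptws_continuous_at => n; rewrite /encode.
case: Cantor.of_nat => [i m].
apply: (@near_continuous_at _ _ _
  (fun y => insert (e i (key z i)) (pending y i) (row_in y i) m)).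
  by apply: filterS (near_key z i) => y ->.
apply: (continuous_at_insert (e_base _ _)).
  exact: pending_continuous.
move=> k; apply: continuous_at_pair; first exact: ptws_proj_continuous.
by apply: continuous_comp; [exact: pending_continuous|exact: kappac].
Qed.

Lemma row_continuous i m : continuous (fun s => row s i m).
Proof. exact: ptws_proj_continuous. Qed.

(** Once the key of the earlier row is frozen, the new key is a continuous function with values in
    [nat]. *)
Lemma near_key_fuel f s i : \forall y \near s, key_fuel f y i = key_fuel f s i.
Proof.
elim: f i => [|f IH] i /=; first by apply: filterE.
case: (i <= r); first by apply: filterE.
case: Cantor.of_nat => [j m].
apply: filterS2 (IH j) (near_nat (continuous_at_snd (continuous_at_delete
  (e_base j (key_fuel f s j)) (fun k => @row_continuous j k s) (n := m)))).
by move=> y -> ->.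
Qed.

Lemma out_pending_continuous i : continuous (out_pending^~ i).
Proof.
move=> s; apply: (@near_continuous_at _ _ _
  (fun y => inserted (e i (out_key s i)) (q i (out_key s i)) (row y i))).
  by apply: filterS (near_key_fuel i.+1 s i) => y yE; rewrite /out_pending /out_key yE.
by apply: (continuous_at_inserted (e_base _ _)) => k; exact: row_continuous.
Qed.

Lemma out_row_continuous i m : continuous (fun s => out_row s i m).
Proof.
move=> s; apply: (@near_continuous_at _ _ _
  (fun y => delete (e i (out_key s i)) (row y i) m)).
  by apply: filterS (near_key_fuel i.+1 s i) => y yE; rewrite /out_row /out_key yE.
by apply: (continuous_at_delete (e_base _ _)) => k; exact: row_continuous.
Qed.

Lemma decode_continuous : continuous decode.
Proof.
move=> s; apply: ptws_continuous_at => k; rewrite /decode.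
case: (k <= r); first exact: out_pending_continuous.
case: (odd _); first exact: out_pending_continuous.
case: Cantor.of_nat => [i m].
by apply: continuous_at_fst; exact: out_row_continuous.
Qed.

Lemma box_homeomorphic :
  homeomorphic_on [set z : Z | forall i, i <= r -> e i 0 0 (z i)] [set: T].
Proof.
exists encode, decode; split=> [z ez|s _].
  by split => //; [exact: encodeK | exact: encode_continuous].
by split; [exact: decode_box | exact: decodeK | exact: decode_continuous].
Qed.

End Coding.

(** * Homeomorphic clopen sets *)

Lemma homeomorphic_on_sym (S T : topologicalType) (A : set S) (B : set T) :
  homeomorphic_on A B -> homeomorphic_on B A.
Proof. by move=> [f [g [fA gB]]]; exists g, f. Qed.

Lemma homeomorphic_on_trans (S T U : topologicalType) (A : set S) (B : set T)
    (C : set U) :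
  homeomorphic_on A B -> homeomorphic_on B C -> homeomorphic_on A C.
Proof.
move=> [f [g [fA gB]]] [f' [g' [fB gC]]]; exists (f' \o f), (g \o g').
split=> x.
  move=> /fA [/fB [Cx g'K f'c] gK fc]; split=> //=; first by rewrite g'K.
  exact: continuous_comp.
move=> /gC [/gB [Ax fK gc] f'K g'c]; split=> //=; first by rewrite fK.
exact: continuous_comp.
Qed.

Lemma homeomorphic_on_preimage (S T : topologicalType) (A : set S) (B D : set T)
    (f : S -> T) (g : T -> S) :
  D `<=` B ->
  (forall x, A x -> [/\ B (f x), g (f x) = x & {for x, continuous f}]) ->
  (forall y, B y -> [/\ A (g y), f (g y) = y & {for y, continuous g}]) ->
  homeomorphic_on (A `&` f @^-1` D) D.
Proof.
move=> DB fA gB; exists f, g; split=> [x [/fA [_ gfx fc]]//|y Dy].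
by have [Agy fgy gc] := gB y (DB y Dy); split => //; split => //=; rewrite fgy.
Qed.

Lemma open_setI_preimage (S T : topologicalType) (A : set S) (D : set T)
    (f : S -> T) :
  open A -> open D -> (forall x, A x -> {for x, continuous f}) ->
  open (A `&` f @^-1` D).
Proof.
rewrite !openE => oA oD fc x [Ax Dx].
by apply: filterI; [exact: oA | apply: (fc x Ax); exact: oD].
Qed.

(** By openness and disjointness, the index of a point is locally constant on the union; [i0] is the
    default outside it. *)
Lemma homeomorphic_on_glue (S T : topologicalType) (I : choiceType) (i0 : I)
    (A : I -> set S) (B : I -> set T) :
  (forall i, open (A i)) -> (forall i, open (B i)) ->
  (forall i j x, A i x -> A j x -> i = j) ->
  (forall i j x, B i x -> B j x -> i = j) ->
  (forall i, homeomorphic_on (A i) (B i)) ->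
  homeomorphic_on (\bigcup_i A i) (\bigcup_i B i).
Proof.
move=> oA oB tA tB /choice [f /choice [g fg]].
pose iA x := xget i0 [set i | A i x]; pose iB y := xget i0 [set i | B i y].
have iAE i x : A i x -> iA x = i.
  by move=> Ax; apply: tA _ (Ax); exact: (@xgetI _ i0 [set i | A i x] i).
have iBE i y : B i y -> iB y = i.
  by move=> By; apply: tB _ (By); exact: (@xgetI _ i0 [set i | B i y] i).
exists (fun x => f (iA x) x), (fun y => g (iB y) y); split=> [x [i _ Ax]|y [i _ By]].
  have [/(_ x Ax) [Bfx gfx fc] _] := fg i.
  rewrite (iAE i) // (iBE i) //; split => //; first by exists i.
  apply: near_continuous_at fc.
  have: nbhs x (A i) by exact: open_nbhs_nbhs.
  by apply: filterS => x' /iAE ->.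
have [_ /(_ y By) [Agy fgy gc]] := fg i.
rewrite (iBE i) // (iAE i) //; split => //; first by exists i.
apply: near_continuous_at gc.
have: nbhs y (B i) by exact: open_nbhs_nbhs.
by apply: filterS => y' /iBE ->.
Qed.

Lemma homeomorphic_set_type (S T : topologicalType) (A : set S) (B : set T) :
  homeomorphic_on A B -> homeomorphic (set_type A) (set_type B).
Proof.
move=> [f [g [fA gB]]].
have fm (a : A) : f (val a) \in B.
  by apply/mem_set; case: (fA (val a) (set_mem (valP a))).
have gm (b : B) : g (val b) \in A.
  by apply/mem_set; case: (gB (val b) (set_mem (valP b))).
have vc (U : topologicalType) (C : set U) : continuous (@set_val U C).
  exact: initial_continuous.
exists (fun a => exist _ (f (val a)) (fm a)), (fun b => exist _ (g (val b)) (gm b)).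
split=> [||a|b].
- apply: continuous_comp_initial => a; apply: (continuous_comp (vc _ _ a)).
  by case: (fA (val a) (set_mem (valP a))).
- apply: continuous_comp_initial => b; apply: (continuous_comp (vc _ _ b)).
  by case: (gB (val b) (set_mem (valP b))).
- by apply: val_inj => /=; case: (fA (val a) (set_mem (valP a))).
- by apply: val_inj => /=; case: (gB (val b) (set_mem (valP b))).
Qed.

(** * Local bases in a space and in its power *)

Lemma clopen_nbhs_ex (X : topologicalType) (x : X) (U : set X) :
  has_clopen_base X -> nbhs x U -> exists V, [/\ clopen V, V x & V `<=` U].
Proof.
move=> [B Bclopen [_ Bx]] /Bx [V [BV Vx] VU].
by exists V; split => //; exact: Bclopen.
Qed.

(** Starting from [W], clopen neighbourhoods of [q] inside the members of a countable local base are
    intersected successively. *)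
Lemma clopen_base_ex (X : topologicalType) (W : set X) :
  has_clopen_base X -> first_countable X -> clopen W -> W !=set0 ->
  exists u q, clopen_base u q /\ u 0 = W.
Proof.
move=> cX fX cW [q Wq]; have [B /pcard_injP [f finj] Bq] := fX q.
have /choice [C CP] : forall n, exists C : set X,
    [/\ clopen C, C q & forall b, B b -> f b = n -> C `<=` b].
  move=> n; case: (pselect (exists2 b, B b & f b = n)) => [[b Bb fb]|nb].
    have : nbhs q b by rewrite Bq; exists b.
    move=> /(clopen_nbhs_ex cX) [C [cC Cq Cb]]; exists C; split => // b' Bb' fb'.
    by rewrite (finj b' b) ?inE // fb fb'.
  (* Numbers outside the image of [f] impose no condition. *)
  exists setT; split => //; first exact: clopenT.
  by move=> b Bb fb; case: nb; exists b.
pose u := fix u n := if n is n'.+1 then u n' `&` C n' else W.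
exists u, q; split => //; split.
- by elim=> // n IH; apply: clopenI => //; case: (CP n).
- by move=> n; exact: subIsetl.
- by elim=> // n IH; split => //; case: (CP n).
(* The set [C n] first enters at [u n.+1]. *)
- move=> U; rewrite Bq => -[b Bb bU]; exists (f b).+1.
  apply: subset_trans bU; apply: subset_trans (@subIsetr _ _ _) _.
  by case: (CP (f b)) => _ _; exact.
Qed.

(** The boxes generate a filter, and its convergence to [z] can be checked on each coordinate
    separately. *)
Lemma box_nbhs (X : topologicalType) (z : {ptws nat -> X}) (C : set {ptws nat -> X}) :
  nbhs z C -> exists r (B : nat -> set X), (forall i, nbhs (z i) (B i)) /\
    [set y : {ptws nat -> X} | forall i, i <= r -> B i (y i)] `<=` C.
Proof.
pose D := [set rB : nat * (nat -> set X) | forall i, nbhs (z i) (rB.2 i)].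
pose box (rB : nat * (nat -> set X)) :=
  [set y : {ptws nat -> X} | forall i, i <= rB.1 -> rB.2 i (y i)].
have FF : Filter (filter_from D box).
  apply: filter_from_filter.
    by exists (0, fun=> setT) => i; exact: filterT.
  move=> [r B] [r' B'] DB DB'.
  exists (maxn r r', fun i => B i `&` B' i) => [i|y yB].
    by apply: filterI; [exact: DB | exact: DB'].
  by split=> i ir; case: (yB i) => //; rewrite /= leq_max ir ?orbT.
suff /[apply] : filter_from D box --> z.
  by move=> [[r B] DB BC]; exists r, B.
apply/cvg_sup => i U [?/= [[W oW <-]] /= Wz /filterS]; apply.
exists (i, fun j => if j == i then W else setT) => [j /=|y /(_ i (leqnn i)) /=].
  by case: eqP => [->|_]; [exact: open_nbhs_nbhs | exact: filterT].
by rewrite eqxx.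
Qed.

Lemma clopen_preimage (S T : topologicalType) (f : S -> T) (A : set T) :
  continuous f -> clopen A -> clopen (f @^-1` A).
Proof.
move=> fc [oA cA]; split; first by move/continuousP: fc; exact.
by move/continuous_closedP: fc; exact.
Qed.

(** * Clopen sets of the power as copies of the power *)

Section Homogeneity.
Context {X : topologicalType}.
Hypotheses (hX : hausdorff_space X) (cX : has_clopen_base X).
Hypothesis fX : first_countable X.
Variable kappa : X -> nat.
Hypotheses (kappac : continuous kappa) (kappas : forall k, exists x, kappa x = k).
Local Notation Z := {ptws nat -> X}.

Lemma clopen_kappa k : clopen (kappa @^-1` [set k]).
Proof.
apply: clopen_preimage kappac _.
by split; [exact: discrete_open | exact: discrete_closed].
Qed.

Lemma box_code r (W : nat -> set X) :
  (forall i, i <= r -> clopen (W i) /\ W i !=set0) ->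
  homeomorphic_on [set z : Z | forall i, i <= r -> W i (z i)]
    [set: {ptws nat -> (X * nat)%type}].
Proof.
(* The fibres of [kappa] are non-empty by surjectivity, so each one also has a base at some
   point. *)
move=> cW; pose V i k := if i <= r then W i else kappa @^-1` [set k].
have /choice [e] : forall i, exists e, forall k, exists q,
    clopen_base (e k) q /\ e k 0 = V i k.
  move=> i; have /choice [e ?] : forall k, exists u, exists q,
    clopen_base u q /\ u 0 = V i k; last by exists e.
  move=> k; rewrite /V; case: leqP => ir; apply: clopen_base_ex => //.
  - by case: (cW i ir).
  - by case: (cW i ir).
  - exact: clopen_kappa.
  - by have [x xk] := kappas k; exists x.
move=> eP; have /choice [q] : forall i, exists q, forall k,
    clopen_base (e i k) (q k) /\ e i k 0 = V i k.
  by move=> i; have /choice [q ?] := eP i; exists q.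
move=> qP.
have -> : [set z : Z | forall i, i <= r -> W i (z i)] =
    [set z : Z | forall i, i <= r -> e i 0 0 (z i)].
  apply/seteqP; split=> z /= zW i ir; have := zW i ir;
  by case: (qP i 0) => _ ->; rewrite /V ir.
apply: (@box_homeomorphic _ kappa r e q) => // [i k|i k ri].
  by case: (qP i k).
by case: (qP i k) => _ ->; rewrite /V leqNgt ri.
Qed.

(** The whole power is itself a box, with the single factor [X], so both sides have the same code
    space. *)
Lemma box_whole r (W : nat -> set X) :
  (forall i, i <= r -> clopen (W i) /\ W i !=set0) ->
  homeomorphic_on [set z : Z | forall i, i <= r -> W i (z i)] [set: Z].
Proof.
move=> cW; apply: homeomorphic_on_trans (box_code cW) _.
apply: homeomorphic_on_sym.
have -> : [set: Z] = [set z : Z | forall i, i <= 0 -> [set: X] (z i)].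
  by apply/seteqP; split.
apply: (@box_code 0 (fun=> setT)) => i _; split; first exact: clopenT.
by have [x _] := kappas 0; exists x.
Qed.

Lemma clopen_box r (W : nat -> set X) :
  (forall i, i <= r -> clopen (W i)) ->
  clopen [set z : Z | forall i, i <= r -> W i (z i)].
Proof.
move=> cW; have cz i : i <= r -> clopen [set z : Z | W i (z i)].
  by move=> /cW; apply: clopen_preimage; exact: ptws_proj_continuous.
have -> : [set z : Z | forall i, i <= r -> W i (z i)] =
    \bigcap_(i in [set i | i <= r]) [set z : Z | W i (z i)] by [].
elim: r {cW} cz => [|r IH] cz.
  rewrite (_ : [set i | i <= 0] = [set 0]); first by rewrite bigcap_set1; exact: cz.
  by apply/seteqP; split=> i /=; rewrite leqn0 => /eqP.
rewrite (_ : [set i | i <= r.+1] = [set r.+1] `|` [set i | i <= r]).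
  rewrite bigcap_setU bigcap_set1; apply: clopenI; first exact: cz.
  by apply: IH => i ir; apply: cz; exact: leqW.
apply/seteqP; split=> i /=; first by rewrite leq_eqVlt => /predU1P.
by case=> [->//|]; exact: leqW.
Qed.

Lemma clopen_whole (C : set Z) :
  clopen C -> C !=set0 -> homeomorphic_on C [set: Z].
Proof.
move=> cC [z Cz].
have [r [B [Bz BC]]] : exists r (B : nat -> set X), (forall i, nbhs (z i) (B i)) /\
    [set y : Z | forall i, i <= r -> B i (y i)] `<=` C.
  by apply: box_nbhs; apply: open_nbhs_nbhs; split => //; case: cC.
have /choice [W WP] : forall i, exists V, [/\ clopen V, V (z i) & V `<=` B i].
  by move=> i; exact: clopen_nbhs_ex.
pose R := [set y : Z | forall i, i <= r -> W i (y i)].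
have RC : R `<=` C.
  by apply: subset_trans BC => y yW i ir; case: (WP i) => _ _; apply; exact: yW.
have [cR [f [g [fR gZ]]]] : clopen R /\ homeomorphic_on R [set: Z].
  split; first by apply: clopen_box => i _; case: (WP i).
  by apply: box_whole => i _; case: (WP i) => ? ? _; split => //; exists (z i).
pose P k := [set y : Z | kappa (y 0) = k].
have PE k : P k = [set y : Z | forall i, i <= 0 -> (kappa @^-1` [set k]) (y i)].
  apply/seteqP; split=> y /= yk => [i|]; last exact: (yk 0).
  by rewrite leqn0 => /eqP ->.
have cP k : clopen (P k).
  rewrite PE; apply: (@clopen_box 0 (fun=> kappa @^-1` [set k])) => i _.
  exact: clopen_kappa.
have /choice [h /choice [h' hh']] : forall k, homeomorphic_on (P k) [set: Z].
  move=> k; rewrite PE; apply: (@box_whole 0 (fun=> kappa @^-1` [set k])) => i _.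
  by split; [exact: clopen_kappa | have [x xk] := kappas k; exists x].
pose E := C `\` R.
have cE : clopen E by rewrite /E setDE; apply: clopenI => //; exact: clopenC.
have hP k x : P k x ->
    [/\ [set: Z] (h k x), h' k (h k x) = x & {for x, continuous (h k)}].
  by case: (hh' k) => + _; exact.
have h'Z k x : [set: Z] x ->
    [/\ P k (h' k x), h k (h' k x) = x & {for x, continuous (h' k)}].
  by case: (hh' k) => _; exact.
have fRc x : R x -> {for x, continuous f} by case/fR.
have hPc k x : P k x -> {for x, continuous (h k)} by case/(hP k).
(* [Q true k] is the copy of [E] inside [P k], and [Q false k] is the rest of [P k]. *)
pose Q (b : bool) k := P k `&` h k @^-1` (if b then E else ~` E).
have oQ b k : open (Q b k).
  apply: open_setI_preimage (hPc k); first by case: (cP k).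
  by case: b; case: cE => // ? ?; exact: closed_openC.
have oRQ b k : open (R `&` f @^-1` (Q b k)).
  exact: open_setI_preimage (proj1 cR) (oQ b k) fRc.
have fRQ b k : homeomorphic_on (R `&` f @^-1` (Q b k)) (Q b k).
  exact: homeomorphic_on_preimage fR gZ.
have EQ k : homeomorphic_on E (Q true k).
  apply: homeomorphic_on_sym.
  exact: (homeomorphic_on_preimage _ (hP k) (h'Z k)).
have tQ b b' k k' x : Q b k x -> Q b' k' x -> (b, k) = (b', k').
  move=> [Pk Ek] [Pk' Ek']; have kk' : k = k' by rewrite -Pk -Pk'.
  by move: Ek Ek'; rewrite kk'; case: b b' => -[].
(* Hilbert hotel: [E] takes the place of [Q true 0], and each copy of [E] in
   [R] moves to the next index. *)
pose A (i : bool * nat) := if i is (true, 0) then E else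
  R `&` f @^-1` (Q i.1 (if i.1 then i.2.-1 else i.2)).
have -> : [set: Z] = \bigcup_i Q i.1 i.2.
  apply/seteqP; split=> // x _.
  case: (pselect (E (h (kappa (x 0)) x))) => Ex.
    by exists (true, kappa (x 0)).
  by exists (false, kappa (x 0)).
have -> : C = \bigcup_i A i.
  apply/seteqP; split=> x; last first.
    by case=> -[[] [|k]] _ /= [] // /RC.
  move=> Cx; case: (pselect (R x)) => Rx; last by exists (true, 0).
  case: (pselect (E (h (kappa (f x 0)) (f x)))) => Ex.
    by exists (true, (kappa (f x 0)).+1).
  by exists (false, kappa (f x 0)).
apply: (homeomorphic_on_glue (true, 0)).
- by case=> -[] [|k]; rewrite /A /=; do ?[exact: oRQ]; case: cE.
- by move=> i; exact: oQ.
- have AE i x : A i x -> i <> (true, 0) ->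
      Q i.1 (if i.1 then i.2.-1 else i.2) (f x) /\ R x.
    by case: i => -[] [|k] //= [].
  have A0 i x : A (true, 0) x -> A i x -> i = (true, 0).
    by move=> [_ nRx] /AE; case: (pselect (i = (true, 0))) => // ? /(_ _) [].
  move=> i j x; case: (pselect (i = (true, 0))) => [-> Ax /(A0 _ _ Ax)//|i0].
  case: (pselect (j = (true, 0))) => [-> + Ax|j0]; first by move/(A0 _ _ Ax).
  move=> /AE /(_ i0) [Qi _] /AE /(_ j0) [Qj _]; have := tQ _ _ _ _ _ Qi Qj.
  by case: i j i0 j0 {Qi Qj} => -[] [|i] [[] [|j]] /=; congruence.
- by move=> [b k] [b' k'] x /= Qi Qj; exact: tQ Qi Qj.
- case=> -[] [|k]; rewrite /A /=; [exact: EQ| | exact: fRQ | exact: fRQ].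
  (* [A (true, k.+1)] is a copy of [Q true k], matched with [Q true k.+1] through [E]. *)
  apply: homeomorphic_on_trans (fRQ _ _) _.
  apply: homeomorphic_on_trans (EQ k.+1).
  exact: homeomorphic_on_sym (EQ k).
Qed.
End Homogeneity.

(** * Infinite clopen partitions *)

(** Infinitely many non-empty members are numbered by [f], and all points outside them go to 0. The
    resulting map is constant on each member of the open partition [V]. *)
Lemma infinite_partition_nat (X : topologicalType) (V : set (set X)) :
  V `<=` open -> cover V id = [set: X] -> trivIset V id -> infinite_set V ->
  exists2 kappa : X -> nat, continuous kappa & forall k, exists x, kappa x = k.
Proof.
move=> oV cV tV iV.
have /infiniteP/ppcard_leP[f] : infinite_set (V `\` [set set0]).
  exact: infinite_setD.
have fV k : V (f k) /\ f k !=set0.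
  by have [? /eqP/set0P] : (V `\` [set set0]) (f k) by exact: funS.
pose kappa (x : X) := xget 0 [set k | f k x].
exists kappa => [x|k].
  apply: near_continuous_at_nat.
  have [A VA Ax] : cover V id x by rewrite cV.
  have: nbhs x A by apply: open_nbhs_nbhs; split => //; exact: oV.
  apply: filterS => y Ay; rewrite /kappa; congr (xget 0 _).
  by apply/seteqP; split=> k fk /=;
    [rewrite (tV (f k) A) //; [case: (fV k)|exists y]
    |rewrite (tV (f k) A) //; [case: (fV k)|exists x]].
have [Vk [x fkx]] := fV k; exists x.
have flx : f (kappa x) x by exact: (@xgetI _ 0 [set k | f k x] k).
apply: (@inj _ _ _ f); rewrite ?inE //.
by apply: tV; [case: (fV (kappa x))| |exists x].
Qed.

Lemma compact_lindelof (T : ptopologicalType) : compact [set: T] -> lindelof T.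
Proof.
rewrite compact_cover => cT U [oU cU].
have [||D DU TD] := cT _ U id; [exact: oU | by rewrite cU|].
exists [set` D]; split.
- by move=> A /= /DU; rewrite inE.
- exact: finite_set_countable.
- by apply/seteqP; split.
Qed.

Lemma finite_partitions_compact (X : ptopologicalType) :
  (forall U : set (set X), open_cover U -> exists V : set (set X),
    [/\ refines V U, cover V id = [set: X] & finite_set V]) ->
  compact [set: X].
Proof.
move=> H; rewrite compact_cover => I D f fo fc.
have cf x : exists2 i, D i & f i x by have [i] := fc x Logic.I; exists i.
have [|V [VU cV fV]] := H (f @` D).
  split=> [_ [i Di <-]|]; first exact: fo.
  by apply/seteqP; split=> // x _; have [i Di fix_] := cf x; exists (f i).
(* [i0] is the value of the choice function at sets outside [V]. *)
have [i0 Di0 _] := cf point.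
have /choice [h hP] : forall A : set X, exists i, D i /\ (V A -> A `<=` f i).
  move=> A; case: (pselect (V A)) => [/VU [_ [i Di <-] Af]|nVA].
    by exists i.
  by exists i0.
have /finite_fsetP [D' D'E] := finite_image h fV.
exists D' => [i iD'|x _].
  have [A _ <-] : (h @` V) i by rewrite D'E.
  by rewrite inE; case: (hP A).
have [A VA Ax] : cover V id x by rewrite cV.
by exists (h A); [rewrite -D'E; exists A | case: (hP A) => _; exact].
Qed.

Theorem proposition28 (X : topologicalType) :
  tychonoff_space X ->
  has_clopen_base X ->
  first_countable X ->
  ultraparacompact {ptws nat -> X} ->
  ~ lindelof {ptws nat -> X} ->
  h_homogeneous {ptws nat -> X}.
Proof.
move=> [hX _] cX fX uX nlX.
suff [kappa kc ks] : exists2 kappa : X -> nat,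
    continuous kappa & forall k, exists x, kappa x = k.
  move=> A B cA cB A0 B0; apply: homeomorphic_set_type.
  apply: homeomorphic_on_trans (clopen_whole hX cX fX kc ks cA A0) _.
  exact: homeomorphic_on_sym (clopen_whole hX cX fX kc ks cB B0).
(* Without [kappa], clopen partitions of [X] are finite, so [X] is compact; by Tychonoff's theorem
   its power is compact, hence Lindelöf. *)
apply: contrapT => nk; apply: nlX.
case: (pselect (exists x : X, True)) => [[x0 _]|nx]; last first.
  move=> U _; exists set0; split => //.
  by apply/seteqP; split=> // z _; case: nx; exists (z 0).
pose Xp : ptopologicalType := HB.pack X (isPointed.Build X x0).
have cpt : compact [set: Xp].
  apply: finite_partitions_compact => U [oU cU].
  (* Ultraparacompactness is given for the power: the cover is lifted along coordinate 0, and the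
     partition found there is restricted to the diagonal. *)
  pose lift (A : set X) : set {ptws nat -> X} :=
    (fun z : {ptws nat -> X} => z 0) @^-1` A.
  have [|V [VU cV Vc tV]] := uX (lift @` U).
    split=> [_ [A UA <-]|].
      move/continuousP : (@ptws_proj_continuous X 0); apply; exact: oU.
    apply/seteqP; split=> // z _.
    have [A UA Az] : cover U id (z 0) by rewrite cU.
    by exists (lift A) => //; exists A.
  pose const (x : X) : {ptws nat -> X} := fun=> x.
  have constc : continuous const.
    by move=> x; apply: ptws_continuous_at => n; exact: cvg_id.
  pose V' := (fun A => const @^-1` A) @` V.
  have cV' : cover V' id = [set: X].
    apply/seteqP; split=> // x _.
    have [A VA Ax] : cover V id (const x) by rewrite cV.
    by exists (const @^-1` A) => //; exists A.
  exists V'; split => //.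
    move=> _ [A VA <-]; have [_ [B UB <-] AB] := VU A VA.
    by exists B => // x /AB.
  apply: contrapT => iV'; apply: nk.
  apply: (@infinite_partition_nat X V') => //.
    by move=> _ [A VA <-]; have [] := clopen_preimage constc (Vc A VA).
  move=> _ _ [A VA <-] [B VB <-] [x [Ax Bx]]; congr (_ @^-1` _).
  by apply: tV => //; exists (const x).
pose Zp : ptopologicalType :=
  HB.pack {ptws nat -> X} (isPointed.Build {ptws nat -> X} (fun=> x0)).
apply: (@compact_lindelof Zp).
have -> : [set: Zp] = [set z | forall i, [set: X] (z i)] by apply/seteqP; split.
exact: (@tychonoff nat (fun=> X) (fun=> setT) (fun=> cpt)).
Qed.
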